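(* Let $d$ be a bounded and continuous distance on $\mathcal{S}^{q-1}$ and let $H$ be a probability distribution on $\mathcal{S}^{q-1}$. Denote by $H_n$ the empirical distribution associated with a random sample of size $n$ from $H$. Then $$\sup_{\theta\in\mathcal{S}^{q-1}}\big|D_d(\theta,H_n)-D_d(\theta,H)\big|\to 0$$ almost surely as $n\to\infty$.
   Context: Let $q\ge 2$ and $\mathcal{S}^{q-1}=\{x\in\mathbb{R}^q: x'x=1\}$, where $'$ denotes transpose. A distance $d$ on $\mathcal{S}^{q-1}$ is a metric on this set; continuity of $d$ is with respect to the usual (Euclidean) topology. For a bounded distance $d$ put $d^{\rm sup}=\sup\{d(\theta,\psi):\theta,\psi\in\mathcal{S}^{q-1}\}$. For a (Borel probability) distribution $H$ on $\mathcal{S}^{q-1}$, the directional $d$-depth of $\theta\in\mathcal{S}^{q-1}$ with respect to $H$ is $D_d(\theta,H)=d^{\rm sup}-E_H[d(\theta,W)]$, where $E_H$ is expectation when $W$ has distribution $H$. The empirical distribution $H_n$ is that of the first $n$ terms $W_1,\dots,W_n$ of a sequence of i.i.d. random vectors with distribution $H$, so that $D_d(\theta,H_n)=d^{\rm sup}-\frac1n\sum_{i=1}^n d(\theta,W_i)$. *)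

(* Defs.v *)
From HB Require Import structures.
From mathcomp Require Import all_boot all_order all_algebra finmap.
From mathcomp Require Import all_classical all_reals all_analysis.

Set Implicit Arguments.
Unset Strict Implicit.
Unset Printing Implicit Defensive.

Import Order.TTheory GRing.Theory Num.Theory.
Import numFieldNormedType.Exports.

Local Open Scope classical_set_scope.
Local Open Scope ring_scope.

(* Vectors are rows, so the condition x'x = 1 reads x *m x^T = 1.  The index m
   is the dimension of the sphere, i.e. unit_sphere R m lies in R^(m+1), which
   guarantees that it is inhabited. *)
Definition unit_sphere (R : realType) (m : nat) : set 'rV[R]_m.+1 :=
  [set x | x *m x^T = 1%:M].

Definition sphere (R : realType) (m : nat) : Type :=
  set_type (@unit_sphere R m).

Section sphere_structures.
Variables (R : realType) (m : nat).

HB.instance Definition _ :=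
  PseudoMetric.copy (sphere R m) (set_type (@unit_sphere R m)).

Fact unit_sphere_delta : delta_mx 0 0 \in @unit_sphere R m.
Proof.
by rewrite inE /unit_sphere /= trmx_delta mul_delta_mx; apply/matrixP => i j;
  rewrite !ord1 !mxE.
Qed.

HB.instance Definition _ := isPointed.Build (sphere R m)
  (exist _ (delta_mx 0 0) unit_sphere_delta : set_type (@unit_sphere R m)).

HB.instance Definition _ := Measurable.copy (sphere R m)
  (g_sigma_algebraType (@open (sphere R m))).

End sphere_structures.

Definition is_distance (R : realType) (T : Type) (d : T -> T -> R) : Prop :=
  [/\ (forall x y, 0 <= d x y),
      (forall x y, d x y = 0 <-> x = y),
      (forall x y, d x y = d y x) &
      (forall x y z, d x z <= d x y + d y z)].

Definition dist_sup (R : realType) (T : Type) (d : T -> T -> R) : R :=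
  sup (range (uncurry d)).

(* Extended-real valued because 'E_H[_] is; it is finite when d is bounded and
   d theta is Borel measurable. *)
Definition depth (R : realType) (m : nat) (d : sphere R m -> sphere R m -> R)
    (theta : sphere R m) (H : probability (sphere R m) R) : \bar R :=
  ((dist_sup d)%:E - 'E_H[d theta])%E.

(* empirical x n is the uniform distribution on the n+1 terms x 0, ..., x n;
   the shift excludes the empty sample. *)
Definition empirical disp (T : measurableType disp) (R : realType)
    (x : nat -> T) (n : nat) : set T -> \bar R :=
  mscale (n.+1%:R^-1)%:nng (msum (fun i => \d_(x i)) n.+1).

Section empirical_probability.
Context disp (T : measurableType disp) (R : realType) (x : nat -> T) (n : nat).

HB.instance Definition _ := Measure.copy (@empirical disp T R x n)
  (mscale (n.+1%:R^-1)%:nng (msum (fun i => \d_(x i)) n.+1)).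

Let empirical_setT : @empirical disp T R x n setT = 1%E.
Proof.
rewrite /empirical /mscale /= /msum.
rewrite (eq_bigr (fun=> 1%E)) => [|i _]; last by rewrite /= diracT.
by rewrite sumEFin sumr_const card_ord -EFinM mulVf.
Qed.

HB.instance Definition _ :=
  Measure_isProbability.Build _ _ _ (@empirical disp T R x n) empirical_setT.

End empirical_probability.

Definition mutually_independent dispO (Omega : measurableType dispO)
    disp (T : measurableType disp) (R : realType) (P : probability Omega R)
    (W : nat -> {RV P >-> T}) : Prop :=
  forall (J : {fset nat}) (B : nat -> set T), (forall i, measurable (B i)) ->
    P (\bigcap_(i in [set` J]) (W i @^-1` B i)) =
    (\prod_(i <- J) P (W i @^-1` B i))%E.

(* Elements of probability T R are functions on all subsets of T, constrained
   only on the measurable ones: laws are hence compared on measurable sets. *)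
Definition has_law dispO (Omega : measurableType dispO)
    disp (T : measurableType disp) (R : realType) (P : probability Omega R)
    (X : {RV P >-> T}) (H : probability T R) : Prop :=
  forall A : set T, measurable A -> distribution P X A = H A.

Definition iid_sample dispO (Omega : measurableType dispO)
    disp (T : measurableType disp) (R : realType) (P : probability Omega R)
    (W : nat -> {RV P >-> T}) (H : probability T R) : Prop :=
  mutually_independent W /\ (forall i, has_law (W i) H).

(* Main.v *)
Require Import Defs.
From HB Require Import structures.
From mathcomp Require Import all_boot all_order all_algebra finmap.
From mathcomp Require Import all_classical all_reals all_analysis.
From mathcomp Require Import measurable_realfun.
From mathcomp Require Import zify ring lra.

Import Order.TTheory GRing.Theory Num.Theory.
Import numFieldNormedType.Exports.

Local Open Scope classical_set_scope.
Local Open Scope ring_scope.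

(** The depth differences are differences of expectations of the functions
    d theta, so the claim is a uniform strong law of large numbers over the
    family of all d theta.  Uniformity comes from the triangle inequality: if a
    set A has all its points within d-distance e of a, then every d theta varies
    by at most e around d theta a on A, whatever theta is.  The sphere is compact
    and the d-balls are open, so for each e the sphere splits into finitely many
    Borel cells of this kind ([finite_small_partition]).  Replacing d theta by a
    function constant on the cells bounds the difference of the expectations
    under two probabilities by 2e plus a constant times the sum over the cells of
    the differences of their probabilities ([Rintegral_dist_le]).  This bound
    does not depend on theta.

    Hence it is enough that the empirical frequency of each of countably many
    cells (finitely many for each e = 1/(k+1)) converges almost surely to its
    probability, which is Borel's strong law ([strong_law_frequencies]).  The
    centred indicators of the events W_i \in A are bounded and, by pairwise
    independence, orthogonal, and for such variables the strong law is elementary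
    ([strong_law_orthogonal]).  The mean of the first k^2 terms has second moment
    O(1/k^2), so the sum over k of the squared means is integrable, hence almost
    surely finite, and the means along the squares tend to 0.  Between k^2 and
    (k+1)^2 there are only O(k) further bounded terms, which the division by
    n >= k^2 makes negligible ([cvg_mean_of_squares]). *)

(** * A strong law for bounded orthogonal variables *)

Lemma ex_sqrt_floor (n : nat) : exists k : nat, (k.+1 ^ 2 <= n.+1 < k.+2 ^ 2)%N.
Proof.
elim: n => [|n [k /andP[kn nk]]]; first by exists 0%N.
have [lt|ge] := ltnP n.+2 (k.+2 ^ 2)%N; first by exists k; lia.
by exists k.+1; rewrite ge; nia.
Qed.

(** Means along the squares control all means of a bounded sequence because the
    gaps between squares are small: for K^2 <= n < (K+1)^2 the terms past K^2
    number at most 2K and contribute at most 2KM/n <= 2M/K to the mean. *)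
Lemma cvg_mean_of_squares (R : realType) (y : nat -> R) (M : R) :
  (forall i, `|y i| <= M) ->
  (fun k => (\sum_(i < k.+1 ^ 2) y i) / (k.+1 ^ 2)%:R) @ \oo --> 0 ->
  (fun n => (\sum_(i < n.+1) y i) / n.+1%:R) @ \oo --> 0.
Proof.
move=> yM /cvgr0Pnorm_le ysq.
have M0 : 0 <= M by exact: (le_trans (normr_ge0 _) (yM 0%N)).
have /cvgr0Pnorm_le hM : (fun k => 2 * M * harmonic k) @ \oo --> 0.
  by rewrite -[X in _ --> X](mulr0 (2 * M)); apply: cvgMr; exact: cvg_harmonic.
apply/cvgr0Pnorm_le => e e0.
have e20 : 0 < e / 2 by rewrite divr_gt0.
have [K1 _ HK1] := ysq _ e20; have [K2 _ HK2] := hM _ e20.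
(* Past this square, the root k of the last square before n is itself at least
   K1 and K2. *)
exists ((maxn K1 K2).+1 ^ 2)%N => // n /= Kn.
have [k /andP[kn nk]] := ex_sqrt_floor n.
have kK : (maxn K1 K2 <= k)%N by nia.
have {HK1} := HK1 k (leq_trans (leq_maxl _ _) kK).
have {HK2} := HK2 k (leq_trans (leq_maxr _ _) kK).
rewrite /= /harmonic => h2 h1; rewrite -(subnKC kn) big_split_ord/= mulrDl.
rewrite (subnKC kn) (le_trans (ler_normD _ _))// [leRHS]splitr lerD//.
  apply: le_trans h1; rewrite !normrM ler_wpM2l// !ger0_norm ?invr_ge0//.
  by rewrite lef_pV2 ?posrE ?ler_nat// ltr0n; lia.
apply: le_trans h2; rewrite [leRHS]ger0_norm ?mulr_ge0 ?invr_ge0//.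
rewrite normrM [X in _ * X]ger0_norm ?invr_ge0// ler_pdivrMr//.
apply: (@le_trans _ _ ((n.+1 - k.+1 ^ 2)%:R * M)).
  apply: le_trans (ler_norm_sum _ _ _) _; apply: le_trans (ler_sum _ _) _.
    by move=> i _; exact: yM.
  by rewrite sumr_const card_ord -[leLHS]mulr_natl.
have -> : 2 * M * k.+1%:R^-1 * n.+1%:R = 2 * n.+1%:R / k.+1%:R * M :> R.
  by move: (k.+1%:R^-1) => a; ring.
rewrite ler_wpM2r// ler_pdivlMr ?ltr0n// -!natrM ler_nat.
by nia.
Qed.

(** The telescoping comparison 1/(k+1)^2 <= 1/k - 1/(k+1). *)
Lemma sum_inv_sqr_le (R : realType) n :
  \sum_(k < n.+1) (k.+1 ^ 2)%:R^-1 <= 2 - n.+1%:R^-1 :> R.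
Proof.
elim: n => [|n IHn]; first by rewrite big_ord1 /=; lra.
rewrite big_ord_recr/= (le_trans (lerD IHn (lexx _)))//.
rewrite natrX -[n.+2%:R]natr1; set a : R := n.+1%:R.
have a0 : 0 < a by rewrite ltr0n.
have a1 : 0 < a + 1 by rewrite addr_gt0.
have -> : (a + 1)^-1 = a^-1 - (a * (a + 1))^-1.
  by field; rewrite !lt0r_neq0.
have : ((a + 1) ^+ 2)^-1 <= (a * (a + 1))^-1.
  rewrite lef_pV2 ?posrE ?exprn_gt0 ?mulr_gt0// expr2 ler_wpM2r ?(ltW a1)//.
  by rewrite lerDl.
set b := (_ ^+ 2)^-1; set c := (_ * _)^-1; set e := a^-1; lra.
Qed.

Lemma nneseries_inv_sqr_lty (R : realType) (C : R) : 0 <= C ->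
  (\sum_(0 <= k <oo) (C / (k.+1 ^ 2)%:R)%:E < +oo)%E.
Proof.
move=> C0; have pos k : (0 <= (C / (k.+1 ^ 2)%:R)%:E)%E.
  by rewrite lee_fin divr_ge0.
apply: (@le_lt_trans _ _ (C * 2)%:E); last by rewrite ltry.
apply: lime_le; first by apply: is_cvg_nneseries => *; exact: pos.
near=> n; rewrite big_mkord sumEFin lee_fin -mulr_sumr ler_wpM2l//.
have -> : n = n.-1.+1 by rewrite prednK//; near: n; exists 1%N.
by apply: le_trans (sum_inv_sqr_le _ _) _; rewrite lerBlDr lerDl invr_ge0.
Unshelve. all: by end_near. Qed.

Lemma integrable_bounded d (T : measurableType d) (R : realType)
    (P : probability T R) (f : T -> R) (M : R) :
  measurable_fun setT f -> (forall x, `|f x| <= M) ->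
  P.-integrable setT (EFin \o f).
Proof.
move=> mf fM; apply: measurable_bounded_integrable => //.
  by rewrite [ltLHS]probability_setT ltry.
by exists M; split; [exact: num_real|move=> y My x _; exact: le_trans (ltW My)].
Qed.

Section strong_law.
Local Open Scope ereal_scope.
Context d (Omega : measurableType d) (R : realType) (P : probability Omega R).
Variables (Y : nat -> Omega -> R) (M : R).
Hypothesis mY : forall i, measurable_fun setT (Y i).
Hypothesis YM : forall i w, (`|Y i w| <= M)%R.
Hypothesis orthY : forall i j, i != j -> \int[P]_w (Y i w * Y j w)%:E = 0.

(** Orthogonality kills the off-diagonal terms of the expanded square, so that
    the second moment of the sum grows only linearly. *)
Lemma second_moment_sum_le n :
  \int[P]_w ((\sum_(i < n) Y i w) ^+ 2)%:E <= (n%:R * M ^+ 2)%:E.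
Proof.
have M0 (w : Omega) : (0 <= M)%R by exact: (le_trans (normr_ge0 _) (YM 0%N w)).
have YYM i j w : (`|Y i w * Y j w| <= M ^+ 2)%R.
  by rewrite normrM expr2 ler_pM.
have intYY i j : P.-integrable setT (fun w => (Y i w * Y j w)%:E).
  by apply: (@integrable_bounded _ _ _ _ _ (M ^+ 2)) => //;
    exact: measurable_funM.
have sqE w : ((\sum_(i < n) Y i w) ^+ 2)%:E =
    \sum_(i < n) \sum_(j < n) (Y i w * Y j w)%:E.
  rewrite expr2 big_distrlr/= -sumEFin.
  by apply: eq_bigr => i _; rewrite sumEFin.
under eq_integral do rewrite sqE.
rewrite integral_sum//; last by move=> i; exact: integrable_sum.
under eq_bigr => i _.
  rewrite integral_sum// (bigD1 i)//= big1 ?adde0; last first.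
    by move=> j ji; apply: orthY; rewrite eq_sym.
  over.
apply: (@le_trans _ _ (\sum_(i < n) (M ^+ 2)%:E)); last first.
  by rewrite sumEFin lee_fin sumr_const card_ord mulr_natl.
apply: lee_sum => i _.
apply: (@le_trans _ _ (\int[P]_w (cst (M ^+ 2)%:E w))).
  apply: ge0_le_integral => //=.
  - by move=> w _; rewrite lee_fin -expr2 sqr_ge0.
  - by apply/measurable_EFinP; exact: measurable_funM.
  - by move=> w _; rewrite lee_fin (le_trans (ler_norm _)).
by rewrite integral_cst// [X in _ * X]probability_setT mule1.
Qed.

(** The series of the squared means along the squares has integral at most the
    sum of the M^2/k^2, so it converges almost everywhere and its terms vanish.
    Summing the second moments in this way replaces Chebyshev's inequality and
    the Borel-Cantelli lemma. *)
Lemma strong_law_orthogonal :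
  {ae P, forall w,
    (fun n => (\sum_(i < n.+1) Y i w) / n.+1%:R)%R @ \oo --> 0%R}.
Proof.
pose a k w := ((\sum_(i < k.+1 ^ 2) Y i w) / (k.+1 ^ 2)%:R)%R.
have ma k : measurable_fun setT (a k).
  by apply: measurable_funM => //; exact: measurable_sum.
have ma2 k : measurable_fun setT (fun w => (a k w ^+ 2)%:E).
  by apply/measurable_EFinP; exact: measurable_funX.
have a2_ge0 k w : 0 <= (a k w ^+ 2)%:E by rewrite lee_fin sqr_ge0.
have a2int : \int[P]_w (\sum_(0 <= k <oo) (a k w ^+ 2)%:E) < +oo.
  rewrite integral_nneseries//.
  apply: le_lt_trans (@nneseries_inv_sqr_lty R (M ^+ 2) (sqr_ge0 _)).
  apply: lee_nneseries => [k _ _|k _].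
    by apply: integral_ge0 => w _; exact: a2_ge0.
  have -> : \int[P]_w (a k w ^+ 2)%:E = ((k.+1 ^ 2)%:R ^+ 2)^-1%:E *
      \int[P]_w ((\sum_(i < k.+1 ^ 2) Y i w) ^+ 2)%:E.
    rewrite -ge0_integralZl//.
    - by apply: eq_integral => w _; rewrite /a expr_div_n mulrC EFinM.
    - apply/measurable_EFinP; apply: measurable_funX; exact: measurable_sum.
    - by move=> w _; rewrite lee_fin sqr_ge0.
  apply: le_trans (lee_wpmul2l _ (second_moment_sum_le _)) _.
    by rewrite lee_fin invr_ge0 sqr_ge0.
  rewrite -EFinM lee_fin expr2 invfM -mulrA mulKf 1?mulrC//.
have : {ae P, forall w, setT w ->
    (\sum_(0 <= k <oo) (a k w ^+ 2)%:E) \is a fin_num}.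
  apply: integrable_ae => //; apply/integrableP; split.
    by apply: ge0_emeasurable_sum.
  under eq_integral do rewrite gee0_abs ?nneseries_ge0//.
  exact: a2int.
apply: filterS => w /(_ I) fin_w.
apply: (@cvg_mean_of_squares _ (Y ^~ w) M) => //.
have /cvg_series_cvg_0 : cvgn (series (fun k => a k w ^+ 2)%R).
  by apply: nnseries_is_cvg => [k|]; rewrite ?sqr_ge0// ltey_eq fin_w.
move=> /cvgr0Pnorm_lt a2; apply/cvgr0Pnorm_lt => e e0.
have := a2 _ (exprn_gt0 2 e0); apply: filterS => k.
by rewrite normrX ltr_pXn2r ?nnegrE// ltW.
Qed.

End strong_law.

(** * Convergence of empirical frequencies *)

Section frequencies.
Context (R : realType) dispO (Omega : measurableType dispO).
Context disp (T : measurableType disp) (P : probability Omega R).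
Variables (W : nat -> {RV P >-> T}) (H : probability T R).
Hypothesis W_iid : iid_sample W H.
Variable A : set T.
Hypothesis mA : measurable A.

Lemma iid_marginal i : P (W i @^-1` A) = H A.
Proof. by have [_ /(_ i A mA)] := W_iid. Qed.

Lemma iid_pair i j : i != j ->
  P (W i @^-1` A `&` W j @^-1` A) = (H A * H A)%E.
Proof.
move=> ij; have [/(_ [fset i; j]%fset (fun=> A) (fun=> mA)) + _] := W_iid.
rewrite big_fsetU1 ?inE//= big_seq_fset1 !iid_marginal => <-.
congr (P _); apply/seteqP; split => [w [Wi Wj] k|w Wk] /=.
  by rewrite !inE => /orP[] /eqP ->.
by split; apply: Wk; rewrite /= !inE eqxx ?orbT.
Qed.

Lemma empiricalE (x : nat -> T) n :
  empirical R x n A = ((\sum_(i < n.+1) \1_A (x i)) / n.+1%:R)%:E.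
Proof.
rewrite /empirical /mscale/= /msum.
rewrite (eq_bigr (fun i : 'I_n.+1 => (\1_A (x i))%:E)).
  by rewrite sumEFin -EFinM mulrC.
by move=> i _; exact: diracE.
Qed.

(** Borel's strong law: the centred indicators of the events W_i \in A are
    orthogonal because their covariance is P(W_i \in A, W_j \in A) - H(A)^2. *)
Lemma strong_law_frequencies : {ae P, forall w,
  (fun n => fine (empirical R (fun i => W i w) n A)) @ \oo --> fine (H A)}.
Proof.
set p := fine (H A).
have HAE : H A = p%:E by rewrite fineK// fin_num_measure.
pose Y i w := \1_A (W i w) - p.
have p01 : 0 <= p <= 1.
  by rewrite -!lee_fin -HAE measure_ge0 probability_le1.
have YM i w : `|Y i w| <= 1.
  rewrite /Y indicE; case: (_ \in _) => /=; rewrite ler_norml; lra.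
have mW i : measurable (W i @^-1` A).
  by rewrite -[X in measurable X]setTI; exact: measurable_funPT.
have mY i : measurable_fun setT (Y i).
  apply: measurable_funB => //.
  exact: (measurable_indic (D := setT) (mW i)).
have YY i j : i != j -> (\int[P]_w (Y i w * Y j w)%:E = 0)%E.
  move=> ij; pose B i := W i @^-1` A.
  have L1 C : measurable C -> (\1_C : Omega -> R) \in Lfun P 1%E.
    move=> mC; apply/Lfun1_integrable.
    apply: (@integrable_bounded _ _ _ _ _ 1) => // w.
    by rewrite indicE; case: (_ \in _); rewrite ?normr1 ?normr0.
  have EB k : ('E_P[\1_(B k)] = p%:E)%E.
    by rewrite expectation_indic; [rewrite -HAE; exact: iid_marginal|exact: mW].
  have -> : (\int[P]_w (Y i w * Y j w)%:E = covariance P \1_(B i) \1_(B j))%E.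
    rewrite covariance.unlock !EB unlock; apply: eq_integral => w _.
    by rewrite /Y /B !indicE.
  have prodE : (\1_(B i) * \1_(B j) = \1_(B i `&` B j) :> (Omega -> R))%R.
    by rewrite indicI.
  have mBB : measurable (B i `&` B j) by apply: measurableI; exact: mW.
  have mB k : measurable (B k) by exact: mW.
  rewrite covarianceE ?prodE ?L1//.
  by rewrite !EB expectation_indic// [P _]iid_pair// HAE subee// -EFinM.
have := @strong_law_orthogonal _ _ _ P Y 1 mY YM YY.
apply: filterS => w cvgY.
rewrite -[X in _ --> X]add0r.
rewrite (_ : (fun n => _) = (fun n =>
    (\sum_(i < n.+1) Y i w) / n.+1%:R + p)); last first.
  apply/funext => n; rewrite empiricalE/= /Y sumrB sumr_const card_ord.
  by rewrite mulrBl -[p *+ _]mulr_natr mulfK// subrK.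
by apply: cvgD => //; exact: cvg_cst.
Qed.

End frequencies.

(** * Topology and Borel sets of the sphere *)

Lemma bounded_unit_sphere (R : realType) m : bounded_set (@unit_sphere R m).
Proof.
exists 1; split => // M M1 x xS; apply: le_trans (ltW M1).
rewrite [leLHS]/Num.norm/= mx_normrE; apply: bigmax_le => // -[i j] _ /=.
rewrite -(ler_pXn2r (ltn0Sn 1)) ?nnegrE// expr1n ord1 real_normK ?num_real//.
have /matrixP/(_ 0 0) := xS; rewrite !mxE eqxx mulr1n => <-.
rewrite (bigD1 j)//= mxE -expr2 lerDl; apply: sumr_ge0 => k _.
by rewrite mxE -expr2 sqr_ge0.
Qed.

Lemma closed_unit_sphere (R : realType) m : closed (@unit_sphere R m).
Proof.
have -> : @unit_sphere R m =
    (fun x : 'rV[R]_m.+1 => \sum_j (x 0 j) ^+ 2) @^-1` [set 1].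
  apply/seteqP; split => x /=; rewrite /unit_sphere/=.
    move=> /matrixP/(_ 0 0); rewrite !mxE eqxx mulr1n => <-.
    by apply: eq_bigr => j _; rewrite mxE expr2.
  move=> x1; apply/matrixP => i j; rewrite !ord1 !mxE eqxx mulr1n -x1.
  by apply: eq_bigr => k _; rewrite mxE expr2.
apply: preimage_closed; last exact: closed_eq.
move=> y _; move: y; apply: (@continuous_big R 'I_m.+1 +%R 0 xpredT) => [|j _ x].
  exact: add_continuous.
have cj := @coord_continuous R 1 m.+1 0 j x.
exact: (cvgM cj cj).
Qed.

(** The sphere carries the topology induced by the inclusion, so a cluster point
    of the image filter in the ambient space, which compactness of the subset
    provides inside it, is a cluster point of the original filter. *)
Lemma compact_sphere (R : realType) m : compact [set: sphere R m].
Proof.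
have : compact (@unit_sphere R m).
  apply: bounded_closed_compact; first exact: bounded_unit_sphere.
  exact: closed_unit_sphere.
move=> cS F PF FT.
pose v (t : sphere R m) : 'rV[R]_m.+1 := set_val t.
have [|x [Sx xF]] := cS (v @ F) _.
  suff: F (v @^-1` @unit_sphere R m) by [].
  by apply: filterS FT => t _; exact: (set_valP t).
exists (exist _ x (mem_set Sx)); split => // B U FB.
move=> [V [[G oG <-] Gx GU]].
have FvB : (v @ F) (v @` B).
  suff: F (v @^-1` (v @` B)) by [].
  by apply: filterS FB => b Bb; exists b.
have [_ [[b Bb <-] Gb]] := xF _ _ FvB (open_nbhs_nbhs (conj oG Gx)).
by exists b; split => //; exact: GU.
Qed.

Lemma measurable_open_sphere (R : realType) m (U : set (sphere R m)) :
  open U -> measurable U.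
Proof. by move=> oU; apply: sub_sigma_algebra. Qed.

Lemma measurable_continuous_sphere (R : realType) m (f : sphere R m -> R) :
  continuous f -> measurable_fun setT f.
Proof.
move=> /continuousP cf.
apply: (measurability _ (RGenOpens.measurableE R)).
move=> _ [_ [a [b ->] <-]]; rewrite setTI.
by apply: measurable_open_sphere; apply: cf; exact: interval_open.
Qed.

(** * Discretization of expectations *)

(** The open d-balls of radius e cover the compact sphere; a finite subcover is
    made disjoint by removing from each ball the previous ones. *)
Lemma finite_small_partition (R : realType) m
    (d : sphere R m -> sphere R m -> R) (e : R) :
  is_distance d -> (forall x, continuous (d x)) -> 0 < e ->
  exists (n : nat) (a : nat -> sphere R m) (A : nat -> set (sphere R m)),
    [/\ forall i, measurable (A i), trivIset setT A,
        \bigcup_(i < n) A i = setT & forall i x, A i x -> d (a i) x <= e].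
Proof.
move=> [_ dxx _ _] dc e0.
have oball x : open (d x @^-1` [set r | r < e]).
  by move/continuousP : (dc x); apply; exact: open_lt.
have := @compact_sphere R m; rewrite compact_cover.
move=> /(_ _ setT (fun x => d x @^-1` [set r | r < e])) [] //.
  by move=> x _; exists x => //=; rewrite (dxx x x).2.
move=> D _ cD; pose s := enum_fset D; pose a i := nth point s i.
pose B i := d (a i) @^-1` [set r | r < e].
have mB i : measurable (B i) by apply: measurable_open_sphere; exact: oball.
exists (size s), a, (seqDU B); split => //.
- exact: seqDU_measurable.
- rewrite bigcup_mkord -bigsetU_seqDU -bigcup_mkord; apply/seteqP.
  split => // x _; have [y /= yD Bx] := cD x I.
  by exists (index y s); rewrite /B /a /= ?index_mem ?nth_index.
- by move=> i x [/= /ltW].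
Qed.

Section discretization.
Context d (T : measurableType d) (R : realType).
Variables (n : nat) (a : nat -> T) (A : nat -> set T).
Hypotheses (mA : forall i, measurable (A i)) (tA : trivIset setT A).
Hypothesis cA : \bigcup_(i < n) A i = setT.
Variables (f : T -> R) (M e : R).
Hypotheses (mf : measurable_fun setT f) (fM : forall x, `|f x| <= M).
Hypothesis fe : forall i x, A i x -> `|f x - f (a i)| <= e.

(** The finite sum is the integral of the function equal to f (a i) on the cell
    A i, which is within e of f everywhere. *)
Lemma Rintegral_partition_dist (Q : probability T R) :
  `|\int[Q]_x f x - \sum_(i < n) f (a i) * fine (Q (A i))| <= e.
Proof.
pose g x := \sum_(i < n) f (a i) * \1_(A i) x.
have fge x : `|f x - g x| <= e.
  have [i /= ilt Aix] : (\bigcup_(i < n) A i) x by rewrite cA.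
  rewrite /g (bigD1 (Ordinal ilt))//= big1 => [|j ji].
    by rewrite indicE mem_set// mulr1 addr0; exact: fe.
  rewrite indicE memNset ?mulr0// => Ajx.
  have /trivIsetP/(_ i j I I) := tA.
  rewrite eq_sym => /(_ ji) /seteqP[+ _] => /(_ x); exact.
have intc k : Q.-integrable setT (fun x => (f (a k) * \1_(A k) x)%:E).
  apply: (@integrable_bounded _ _ _ _ _ `|f (a k)|).
    exact: measurable_funM.
  by move=> x; rewrite indicE; case: (_ \in _);
    rewrite ?mulr1 ?mulr0 ?normr0.
have intf : Q.-integrable setT (EFin \o f).
  exact: (@integrable_bounded _ _ _ _ _ M).
have gE : (EFin \o g) = (fun x => \sum_(i < n) (f (a i) * \1_(A i) x)%:E)%E.
  by apply/funext => x; rewrite sumEFin.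
have intg : Q.-integrable setT (EFin \o g).
  by rewrite gE; exact: integrable_sum.
have -> : \sum_(i < n) f (a i) * fine (Q (A i)) = \int[Q]_x g x.
  suff intgE : (\int[Q]_x (EFin \o g) x =
      (\sum_(i < n) f (a i) * fine (Q (A i)))%:E)%E.
    by rewrite /Rintegral intgE.
  rewrite gE integral_sum// -sumEFin; apply: eq_bigr => i _.
  under eq_integral do rewrite EFinM.
  rewrite integralZl//; last first.
    apply: (@integrable_bounded _ _ _ _ _ 1) => // x.
    by rewrite indicE; case: (_ \in _); rewrite ?normr1 ?normr0.
  by rewrite integral_indic// setIT EFinM fineK// fin_num_measure.
rewrite -RintegralB//.
have intfg : Q.-integrable setT (EFin \o (f \- g)).
  have -> : EFin \o (f \- g) = ((EFin \o f) \- (EFin \o g))%E by [].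
  exact: integrableB.
apply: le_trans (le_normr_Rintegral _ intfg) _ => //.
have -> : e = \int[Q]_x e.
  rewrite Rintegral_cst// [X in fine X]probability_setT mulr1//.
apply: le_Rintegral => //.
- exact: integrable_norm.
- exact: (@integrable_bounded _ _ _ _ _ `|e|).
- by move=> x _; exact: fge.
Qed.

(** The bound involves f only through M and e, which is what makes it uniform
    over a family of functions sharing these constants. *)
Lemma Rintegral_dist_le (Q1 Q2 : probability T R) :
  `|\int[Q1]_x f x - \int[Q2]_x f x| <=
    2 * e + M * \sum_(i < n) `|fine (Q1 (A i)) - fine (Q2 (A i))|.
Proof.
set S := \sum_(i < n) _.
have h1 := Rintegral_partition_dist Q1.
have h2 := Rintegral_partition_dist Q2.
have h3 : `|\sum_(i < n) f (a i) * fine (Q1 (A i)) -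
    \sum_(i < n) f (a i) * fine (Q2 (A i))| <= M * S.
  rewrite -sumrB mulr_sumr; apply: le_trans (ler_norm_sum _ _ _) _.
  by apply: ler_sum => i _; rewrite -mulrBr normrM ler_wpM2r.
move: h1 h2 h3; rewrite !ler_distl.
move=> /andP[? ?] /andP[? ?] /andP[? ?]; apply/andP; split; lra.
Qed.

End discretization.

(** * Uniform convergence of the depth *)

Lemma cvge0_squeeze (R : realType) (u : nat -> \bar R) :
  (forall e : R, 0 < e -> \forall n \near \oo, (0 <= u n <= e%:E)%E) ->
  u @ \oo --> 0%E.
Proof.
move=> ue; apply/fine_cvgP; split.
  have := ue 1 ltr01; apply: filterS => n /andP[u0 u1].
  by rewrite ge0_fin_numE// (le_lt_trans u1)// ltry.
apply/cvgr0Pnorm_le => e e0; have := ue e e0.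
apply: filterS => n /andP[u0 une]/=.
have fu : u n \is a fin_num by rewrite ge0_fin_numE// (le_lt_trans une)// ltry.
by rewrite ger0_norm ?fine_ge0// -lee_fin fineK.
Qed.

(** The term dist_sup d cancels, and boundedness of d theta makes the
    expectations finite, so that the computation can take place in R. *)
Lemma depth_dist (R : realType) m (d : sphere R m -> sphere R m -> R) (M : R)
    (Q1 Q2 : probability (sphere R m) R) theta :
  measurable_fun setT (d theta) -> (forall x, `|d theta x| <= M) ->
  (`|depth d theta Q1 - depth d theta Q2| =
   `|\int[Q1]_x d theta x - \int[Q2]_x d theta x|%:E)%E.
Proof.
move=> md dM.
have EE (Q : probability (sphere R m) R) :
    'E_Q[d theta]%E = (\int[Q]_x d theta x)%:E.
  rewrite unlock /Rintegral fineK//; apply: integrable_fin_num => //.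
  exact: (@integrable_bounded _ _ _ _ _ M).
by rewrite /depth !EE -!EFinB abse_EFin distrC; congr (`|_|)%:E; ring.
Qed.

Theorem theorem6 (R : realType) (q : nat) (hq : (2 <= q)%N)
    (d : sphere R q.-1 -> sphere R q.-1 -> R)
    (d_dist : is_distance d)
    (d_bounded : bounded_fun (uncurry d))
    (d_cont : continuous (uncurry d))
    (H : probability (sphere R q.-1) R)
    (dispO : measure_display) (Omega : measurableType dispO)
    (P : probability Omega R)
    (W : nat -> {RV P >-> sphere R q.-1})
    (W_iid : iid_sample W H) :
  {ae P, forall w : Omega,
    ereal_sup (range (fun theta : sphere R q.-1 =>
      `|depth d theta (empirical R (fun i => W i w) n) - depth d theta H|%E))
      @[n --> \oo] --> 0%E}.
Proof.
have [M dM] : exists M, forall x y, `|d x y| <= M.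
  have [M [_ bM]] := d_bounded; exists (M + 1) => x y.
  by apply: (bM _ _ (x, y) I); rewrite ltrDl.
have dc x : continuous (d x) by exact: (continuous_curry d_cont).2.
have md x : measurable_fun setT (d x) by exact: measurable_continuous_sphere.
have part k := @finite_small_partition R q.-1 d (harmonic k) d_dist dc
  (harmonic_gt0 k).
have [N /choice[a /choice[A hA]]] := choice part.
(* A single null set serves all radii 1/(k+1) and all their cells, since there
   are countably many of them. *)
have : {ae P, forall w, forall k i,
    (fun n => fine (empirical R (fun i => W i w) n (A k i))) @ \oo -->
    fine (H (A k i))}.
  apply: ae_foralln => k; apply: ae_foralln => i.
  by apply: strong_law_frequencies => //; have [/(_ i)] := hA k.
apply: filterS => w freq; apply: cvge0_squeeze => e e0.
have e4 : 0 < e / 4 by rewrite divr_gt0.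
have e2 : 0 < e / 2 by rewrite divr_gt0.
(* A radius e/4 costs 2 * (e/4), leaving e/2 for the frequencies. *)
have [k ke] : exists k, harmonic k <= e / 4 :> R.
  have /cvgr0Pnorm_le/(_ _ e4)[k _ /(_ k (leqnn k))] := @cvg_harmonic R.
  by rewrite /= ger0_norm ?harmonic_ge0//; exists k.
have [mA tA cA Ae] := hA k.
pose S n := \sum_(i < N k)
  `|fine (empirical R (fun i => W i w) n (A k i)) - fine (H (A k i))|.
have : (fun n => M * S n) @ \oo --> 0.
  rewrite -[X in _ --> X](mulr0 M); apply: cvgMr.
  rewrite [X in _ --> X](_ : 0 = \sum_(i < N k) 0); last by rewrite big1.
  apply: (cvg_big (op := +%R)) => [|i _]; first exact: add_continuous.
  have := freq k i; rewrite -subr_cvg0 => /cvg_norm; rewrite normr0; exact.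
move=> /cvgr0Pnorm_le/(_ _ e2); apply: filterS => n Sn.
apply/andP; split.
  apply: (@le_trans _ _ `|depth d point (empirical R (fun i => W i w) n) -
    depth d point H|%E); first exact: abse_ge0.
  by apply: ereal_sup_ubound; exists point.
apply: ge_ereal_sup => _ [theta _ <-].
rewrite (@depth_dist _ _ _ M)// lee_fin.
apply: le_trans (@Rintegral_dist_le _ _ _ (N k) (a k) (A k) mA tA cA
  (d theta) M (harmonic k) (md _) (dM theta) _ _ _) _.
  move=> i x Aix; have [d0 dxx dC dtri] := d_dist.
  (* The oscillation of d theta on a cell is bounded uniformly in theta by the
     triangle inequality in both directions. *)
  rewrite ler_distl; have := dtri theta (a k i) x; have := dtri theta x (a k i).
  have := Ae i x Aix; rewrite (dC x) => *; apply/andP; split; lra.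
have := ler_norm (M * S n); rewrite -/(S n); lra.
Qed.
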